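(* Let $(X,d)$ be a metric space, let $x_0\in X$ and $r\ge 0$, and let $C_{x_0,r}=\{x\in X: d(x_0,x)=r\}$. Define $\varphi:X\to[0,\infty)$ by $\varphi(x)=d(x,x_0)$ for all $x\in X$. If there exists a self-mapping $T:X\to X$ satisfying (C1) $d(x,Tx)\le \varphi(x)-\varphi(Tx)$ and (C2) $d(Tx,x_0)\ge r$ for each $x\in C_{x_0,r}$, then $C_{x_0,r}$ is a fixed circle of $T$, i.e. $Tx=x$ for every $x\in C_{x_0,r}$.
   Context: For a metric space $(X,d)$, the circle with center $x_0\in X$ and radius $r$ is $C_{x_0,r}=\{x\in X: d(x_0,x)=r\}$. For a self-mapping $T:X\to X$, the circle $C_{x_0,r}$ is called a fixed circle of $T$ if $Tx=x$ for every $x\in C_{x_0,r}$. *)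

(* Defs.v *)
From Stdlib Require Import Reals.
Open Scope R_scope.

Record is_metric (X : Type) (d : X -> X -> R) : Prop := {
  metric_nonneg : forall x y, 0 <= d x y;
  metric_eq0 : forall x y, d x y = 0 <-> x = y;
  metric_sym : forall x y, d x y = d y x;
  metric_triangle : forall x y z, d x z <= d x y + d y z
}.

Definition circle {X : Type} (d : X -> X -> R) (x0 : X) (r : R) : X -> Prop :=
  fun x => d x0 x = r.

Definition fixed_circle {X : Type} (d : X -> X -> R) (T : X -> X) (x0 : X) (r : R) : Prop :=
  forall x, circle d x0 r x -> T x = x.

(* Main.v *)
Require Import Defs.
From Stdlib Require Import Reals Lra.
Open Scope R_scope.

Lemma metric_le0_eq (X : Type) (d : X -> X -> R) (Hd : is_metric X d) (x y : X) :
  d x y <= 0 -> x = y.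
Proof.
  intros Hle.
  apply (metric_eq0 _ _ Hd).
  pose proof (metric_nonneg _ _ Hd x y).
  lra.
Qed.

Lemma metric_eq_of_le_sub (X : Type) (d : X -> X -> R) (Hd : is_metric X d)
  (x y z : X) :
  d x y <= d x z - d y z -> d x z <= d y z -> x = y.
Proof.
  intros Hcost Hfar.
  apply (metric_le0_eq _ _ Hd).
  lra.
Qed.

Theorem theorem2p2 (X : Type) (d : X -> X -> R) (Hd : is_metric X d)
  (x0 : X) (r : R) (Hr : 0 <= r) (T : X -> X) :
  let phi := fun x : X => d x x0 in
  (forall x, circle d x0 r x ->
     d x (T x) <= phi x - phi (T x) /\ d (T x) x0 >= r) ->
  fixed_circle d T x0 r.
Proof.
  intros phi HT x Hx.
  destruct (HT x Hx) as [Hcost Hfar].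
  symmetry.
  apply (metric_eq_of_le_sub _ _ Hd x (T x) x0); [exact Hcost |].
  unfold circle in Hx.
  rewrite (metric_sym _ _ Hd x x0), Hx.
  lra.
Qed.
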